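(* Let $n\ge 1$ and let $T$ be the $n\times n$ matrix with entries $$T_{ij}=1+\operatorname{sgn}(i-j)=\begin{cases}0,& i<j,\\ 1,& i=j,\\ 2,& i>j,\end{cases}$$ and let $X$ be an arbitrary symmetric $n\times n$ matrix. Then, for every $1\le k\le n$, the sum of the $k\times k$ principal minors of $TX$ equals the sum of all $k\times k$ minors of $X$ (principal and non-principal).
   Context: For an $n\times n$ matrix $A$ and $k$-element subsets $I=\{i_1<\dots<i_k\}$, $J=\{j_1<\dots<j_k\}$ of $[n]=\{1,\dots,n\}$, the minor $|A_{IJ}|$ is the determinant of the $k\times k$ matrix $(a_{i_r j_s})_{r,s=1}^k$. A principal minor is one with $I=J$. The sum of all $k\times k$ minors means the sum of $|X_{IJ}|$ over all pairs $(I,J)$ of $k$-element subsets of $[n]$. *)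

(* Defs.v *)
From mathcomp Require Import all_boot all_order all_algebra.

Set Implicit Arguments.
Unset Strict Implicit.
Unset Printing Implicit Defensive.

Import Order.TTheory GRing.Theory Num.Theory.
Local Open Scope ring_scope.

Definition kset (n k : nat) := {I : {set 'I_n} | #|I| == k}.

(* The r-th element of I in increasing order; ranks start at 0. *)
Definition kset_nth (n k : nat) (I : kset n k) (r : 'I_k) : 'I_n :=
  enum_val (cast_ord (esym (eqP (valP I))) r).

Lemma kset_nth_lt (n k : nat) (I : kset n k) (r s : 'I_k) :
  (r < s)%N -> (kset_nth I r < kset_nth I s)%N.
Proof.
move=> rs; have hn : (0 < n)%N by case: (kset_nth I r) => m; case: n {I}.
case: n I hn => // n I _.
have sz : size (enum (val I)) = k by rewrite -cardE; exact/eqP/(valP I).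
rewrite /kset_nth !(enum_val_nth ord0) /=.
have srt : sorted (fun x y : 'I_n.+1 => (x < y)%N) (enum (val I)).
  rewrite /enum_mem; apply: sorted_filter; first by move=> x y z; exact: ltn_trans.
  by have := iota_ltn_sorted 0 n.+1; rewrite -val_enum_ord sorted_map enumT.
apply: (sorted_ltn_nth _ ord0 srt) => //.
- by move=> x y z; exact: ltn_trans.
- by rewrite inE sz.
- by rewrite inE sz.
Qed.

Lemma kset_nth_image (n k : nat) (I : kset n k) :
  [set kset_nth I r | r : 'I_k] = val I.
Proof.
apply/setP => x; apply/imsetP/idP => [[r _ ->]|xI]; first exact: enum_valP.
exists (cast_ord (eqP (valP I)) (enum_rank_in xI x)) => //.
by rewrite /kset_nth cast_ordK enum_rankK_in.
Qed.

Definition minor (R : comNzRingType) (n k : nat) (A : 'M[R]_n)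
  (I J : kset n k) : R :=
  \det (\matrix_(r < k, s < k) A (kset_nth I r) (kset_nth J s)).

Definition Tmx (R : comNzRingType) (n : nat) : 'M[R]_n :=
  \matrix_(i, j) (1 + (sgz ((i : nat)%:Z - (j : nat)%:Z))%:~R).

Lemma TmxE (R : comNzRingType) (n : nat) (i j : 'I_n) :
  Tmx R n i j = if (i < j)%N then 0 else if i == j then 1 else 2.
Proof.
rewrite mxE -val_eqE /=; case: ltngtP => [ij|ij|->].
- by rewrite ltr0_sgz ?subr_lt0 ?ltz_nat // mulrN1z subrr.
- by rewrite gtr0_sgz ?subr_gt0 ?ltz_nat.
- by rewrite subrr sgz0 mulr0z addr0.
Qed.

(* Main.v *)
Require Import Defs.
From mathcomp Require Import all_boot all_order all_algebra all_fingroup.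
From mathcomp Require Import ring.

Set Implicit Arguments.
Unset Strict Implicit.
Unset Printing Implicit Defensive.

Import Order.TTheory GRing.Theory Num.Theory.
Local Open Scope ring_scope.

(* Write [X = V D V^T] with [V] integral and [D] diagonal.  By the Cauchy-Binet
   formula both sides become sums over k-sets of columns of [V], and the theorem
   reduces to [det (V^T T V) = g(V)^2] for an n x k matrix [V] over the
   rationals, where [g(V)] is the sum of the maximal minors of [V].  Both sides
   of this identity are multiplied by [det P ^ 2] when [V] is replaced by [V P].
   Choose [P] so that the first column [v] of [V] has sum zero and the first row
   of [V^T T V] is [(0, c, 0, ..., 0)]; as [T + T^T] is the constant matrix 2,
   the first column is then [(0, -c, 0, ..., 0)^T].  If [V'] is [V]
   without its first two columns, then [det (V^T T V) = c^2 det (V'^T T V')],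
   and [g(V) = - c g(V')] thanks to the expansion
   [g(v | W) + sum_l (v^T T)_l Psi_l = (sum_i v_i) g(W)],
   where [Psi_l] is the sum of the determinants of all matrices formed by row
   [l] of [W] followed by an increasing choice of rows of [W]. *)

(** * Increasing selections from a list *)

Fixpoint subseqs (T : Type) (k : nat) (s : seq T) : seq (seq T) :=
  match k, s with
  | 0, _ => [:: [::]]
  | _.+1, [::] => [::]
  | k'.+1, x :: s' => map (cons x) (subseqs k' s') ++ subseqs k s'
  end.

Lemma mem_subseqs (T : eqType) k (s t : seq T) :
  (t \in subseqs k s) = subseq t s && (size t == k).
Proof.
have cons_mem (x : T) (u : seq T) ss : (u \in map (cons x) ss) =
    if u is y :: u' then (y == x) && (u' \in ss) else false.
  apply/mapP; case: u => [[] //|y u']; case: eqP => /= [->|ne]; last by case=> v _ [].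
  by case: (boolP (u' \in ss)) => h; [exists u' | case=> v vs [uv]; rewrite uv vs in h].
elim: s k t => [|x s IH] [|k] t /=; rewrite ?inE.
- by case: t.
- by case: t.
- by case: t => [//|y t]; rewrite eqE /= andbF.
- rewrite mem_cat cons_mem !IH; case: t => [|y t]; first by rewrite andbF.
  rewrite /= eqSS; case: eqP => [->|] //=; rewrite IH.
  case: (boolP (subseq t s)) => [ts|nts] /=.
    by case: (size t == k); rewrite ?andbF ?andbT.
  case: (boolP (subseq (x :: t) s)) => [h|] //=.
  by rewrite (subseq_trans (subseq_cons t x) h) in nts.
Qed.

Lemma uniq_subseqs (T : eqType) k (s : seq T) : uniq s -> uniq (subseqs k s).
Proof.
elim: s k => [|x s IH] [|k] //= /andP[xs us].
rewrite cat_uniq !IH // map_inj_uniq ?IH //; last by move=> u v [].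
rewrite andbT; apply/hasPn => t; rewrite mem_subseqs => /andP[ts _].
apply/mapP => -[u _ tE]; case/negP: xs.
by apply: (mem_subseq ts); rewrite tE mem_head.
Qed.

(** Lets sums over k-sets be treated by induction on the list of indices, splitting off the smallest
    one. *)
Lemma subseqs_enum n k :
  perm_eq (subseqs k (enum 'I_n)) [seq enum (val A) | A : kset n k].
Proof.
apply: uniq_perm; first by rewrite uniq_subseqs ?enum_uniq.
  rewrite map_inj_uniq ?enum_uniq // => I J /= eIJ; apply/val_inj/setP => x.
  by rewrite -[LHS]mem_enum eIJ mem_enum.
move=> t; rewrite mem_subseqs; apply/andP/mapP => [[ts /eqP tk]|[I _ ->]].
  have tE : t = enum [set x in t].
    have /(subseq_uniqP (enum_uniq _)) tE := ts.
    rewrite [LHS]tE enumT /enum_mem; apply: eq_filter => x /=.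
    by rewrite !inE.
  have cardt : #|[set x in t]| == k by rewrite cardE -tE tk.
  by exists (exist _ [set x in t] cardt); rewrite ?mem_enum.
split; last by rewrite -cardE; exact: (valP I).
rewrite {1}/enum_mem -enumT; exact: filter_subseq.
Qed.

(** * Expansion of alternating functions of lists *)

Section SubseqSum.
Variables (T : Type) (R : comNzRingType).
Implicit Types (phi psi : T -> R) (F : seq T -> R) (s t : seq T).

Definition subsum k s F := \sum_(t <- subseqs k s) F t.

Lemma subsum0 s F : subsum 0 s F = F [::].
Proof. by case: s => [|x s]; rewrite /subsum /= big_seq1. Qed.

Lemma subsum_nil k F : subsum k.+1 [::] F = 0.
Proof. by rewrite /subsum big_nil. Qed.

Lemma subsum_cons k x s F :
  subsum k.+1 (x :: s) F = subsum k s (F \o cons x) + subsum k.+1 s F.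
Proof. by rewrite /subsum /= big_cat big_map. Qed.

Lemma subsumD k s F G : subsum k s (F \+ G) = subsum k s F + subsum k s G.
Proof. exact: big_split. Qed.

Lemma subsumN k s F : subsum k s (fun t => - F t) = - subsum k s F.
Proof. exact: sumrN. Qed.

Lemma subsumZ k s a F : subsum k s (fun t => a * F t) = a * subsum k s F.
Proof. by rewrite /subsum mulr_sumr. Qed.

Lemma eq_subsum k s F G : F =1 G -> subsum k s F = subsum k s G.
Proof. by move=> FG; apply: eq_bigr => t _; apply: FG. Qed.

(** Vanishing at a repeated entry is a separate clause, since the sign rule alone gives only
    [2 * F t = 0] there. *)
Definition alternating F :=
  (forall p x t, F (p ++ x :: x :: t) = 0) /\
  (forall p x y t, F (p ++ x :: y :: t) = - F (p ++ y :: x :: t)).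

Lemma alternating_cons F x : alternating F -> alternating (F \o cons x).
Proof. by case=> F0 FN; split=> [p y t|p y z t] /=; rewrite -!cat_cons. Qed.

(* Expansion of a determinant along the column [phi], [F] being the determinant
   of the remaining columns. *)
Fixpoint laplace phi F t : R :=
  if t is x :: t' then phi x * F t' - laplace phi (F \o cons x) t' else 0.

(* The bilinear form of T, with the entries of [s] as its increasing indices. *)
Fixpoint tri_form phi psi s : R :=
  if s is x :: s' then
    (phi x + 2 * \sum_(i <- s') phi i) * psi x + tri_form phi psi s'
  else 0.

Lemma tri_formB phi psi1 psi2 s :
  tri_form phi (fun x => psi1 x - psi2 x) s =
  tri_form phi psi1 s - tri_form phi psi2 s.
Proof. by elim: s => [|x s /= ->]; rewrite /= ?subr0 //; ring. Qed.

Lemma eq_tri_form phi psi1 psi2 s :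
  psi1 =1 psi2 -> tri_form phi psi1 s = tri_form phi psi2 s.
Proof. by move=> e; elim: s => //= x s ->; rewrite e. Qed.

(** The [Psi_l] of the overview: [x] is put in front of a selection without being sorted into it.
    For [k = 0] there is no position for [x], hence the value 0. *)
Definition presum k s F (x : T) : R :=
  if k is k'.+1 then subsum k' s (F \o cons x) else 0.

Lemma presum_head k x s F : alternating F ->
  presum k.+1 (x :: s) F x = subsum k s (F \o cons x).
Proof.
move=> [F0 _] /=; case: k => [|k]; first by rewrite !subsum0.
rewrite subsum_cons; rewrite [X in X + _](_ : _ = 0) ?add0r //.
by rewrite /subsum big1 // => t _ /=; apply: (F0 [::]).
Qed.

(** In the selections that start with [x], moving [y] behind [x] costs the sign. *)
Lemma presum_cons k x s F y : alternating F ->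
  presum k.+1 (x :: s) F y = presum k.+1 s F y - presum k s (F \o cons x) y.
Proof.
move=> [_ FN] /=; case: k => [|k]; first by rewrite !subsum0 subr0.
rewrite subsum_cons addrC; congr (_ + _); rewrite -subsumN.
by apply: eq_subsum => t /=; apply: (FN [::]).
Qed.

(** Induction on [s]. For the choices that start with the head [x], the induction hypothesis at
    [F \o cons x] produces the sum of [phi] over the tail with a minus sign; the coefficient 2 in
    [tri_form] turns it into a plus. *)
Lemma subsum_laplace k s phi F : alternating F ->
  subsum k.+1 s (laplace phi F) + tri_form phi (presum k s F) s =
  (\sum_(x <- s) phi x) * subsum k s F.
Proof.
elim: s k F => [|x s IH] k F altF; first by rewrite subsum_nil big_nil mul0r addr0.
have altFx := alternating_cons x altF.
rewrite subsum_cons big_cons.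
have -> : subsum k s (laplace phi F \o cons x) =
    phi x * subsum k s F - subsum k s (laplace phi (F \o cons x)).
  by rewrite -subsumZ -subsumN -subsumD.
case: k => [|k].
  have := IH 0%N F altF; rewrite !subsum0 /= !mulr0 add0r.
  have tri0 u : tri_form phi (fun=> 0) u = 0.
    by elim: u => //= y u ->; rewrite mulr0 addr0.
  by rewrite /presum !tri0 !addr0 subr0 => ->; rewrite mulrDl.
rewrite [tri_form _ _ _]/= -/(presum k.+1 (x :: s) F x) presum_head //.
rewrite -/(presum k.+1 (x :: s) F).
rewrite (eq_tri_form phi s (fun y => presum_cons k x s y altF)) tri_formB.
rewrite subsum_cons.
have h1 := IH k.+1 F altF.
have h2 := IH k _ altFx.
rewrite (canRL (addrK _) h1) (canRL (addrK _) h2); ring.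
Qed.

End SubseqSum.

Lemma laplaceE (T : Type) (R : comNzRingType) (x0 : T) phi F (t : seq T) :
  laplace phi F t = \sum_(p < size t)
    (-1) ^+ p * (phi (nth x0 t p) * F (take p t ++ drop p.+1 t)) :> R.
Proof.
elim: t F => [|x t IH] F /=; first by rewrite big_ord0.
rewrite big_ord_recl /= expr0 mul1r drop0 IH -sumrN; congr (_ + _).
by apply: eq_bigr => p _; rewrite /= exprS mulN1r mulNr.
Qed.

Lemma nth_take_drop (T : Type) (x0 : T) p (t : seq T) r : (p < size t)%N ->
  nth x0 (take p t ++ drop p.+1 t) r = nth x0 t (bump p r).
Proof.
move=> pt; rewrite nth_cat size_takel ?(ltnW pt) // /bump.
case: ltnP => rp; first by rewrite nth_take.
by rewrite nth_drop addSn subnKC.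
Qed.

(** The head [x] of an increasing list is its least index: column [x] of T reads 1 at [x] and 2 at
    the later indices, and row [x] is 0 in their columns. *)
Lemma tri_form_Tmx (R : comNzRingType) n phi psi (s : seq 'I_n) :
  sorted (fun i j : 'I_n => (i < j)%N) s ->
  tri_form phi psi s =
  \sum_(l <- s) (\sum_(i <- s) phi i * Tmx R n i l) * psi l.
Proof.
rewrite sorted_pairwise; last by move=> x y z; exact: ltn_trans.
elim: s => [|x s IH] /=; first by rewrite big_nil.
case/andP=> /allP xs srt; rewrite !big_cons IH //; congr (_ + _).
  rewrite TmxE ltnn eqxx mulr1 mulr_sumr; congr ((_ + _) * _).
  rewrite [RHS]big_seq [LHS]big_seq; apply: eq_bigr => i /xs xi.
  by rewrite TmxE ltnNge (ltnW xi) -val_eqE /= gtn_eqF // mulrC.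
rewrite [RHS]big_seq [LHS]big_seq; apply: eq_bigr => l /xs xl.
by rewrite big_cons TmxE xl mulr0 add0r.
Qed.

Lemma sorted_enum_ord n : sorted (fun i j : 'I_n => (i < j)%N) (enum 'I_n).
Proof. by have := iota_ltn_sorted 0 n; rewrite -val_enum_ord sorted_map. Qed.

(** * Sums of maximal minors *)

Section MinorSum.
Variable R : comNzRingType.

Definition minor_sum n k (V : 'M[R]_(n, k)) : R :=
  \sum_(I : kset n k) \det (rowsub (kset_nth I) V).

(** The value 0 at lists of the wrong length makes this alternating on all lists. Taking [nth] among
    rows avoids a default index, as ['I_n] may be empty. *)
Definition detrows n k (V : 'M[R]_(n, k)) (t : seq 'I_n) : R :=
  if size t == k then \det (\matrix_(r < k) nth 0 [seq row i V | i <- t] r)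
  else 0.

Lemma detrowsE n k (V : 'M[R]_(n, k)) x0 t : size t = k ->
  detrows V t = \det (\matrix_(r, c) V (nth x0 t r) c).
Proof.
move=> tk; rewrite /detrows tk eqxx; congr (\det _); apply/matrixP => r c.
by rewrite !mxE (nth_map x0) ?tk // mxE.
Qed.

Lemma minor_sumE n k (V : 'M[R]_(n, k)) :
  minor_sum V = subsum k (enum 'I_n) (detrows V).
Proof.
rewrite /subsum (perm_big _ (subseqs_enum n k)) big_map big_enum.
apply: eq_bigr => A _; have sz : size (enum (val A)) = k.
  by rewrite -cardE; exact/eqP/(valP A).
rewrite /detrows sz eqxx; congr (\det _); apply/matrixP => r c.
rewrite !mxE (nth_map (kset_nth A r)) ?sz // mxE.
by rewrite {1}/kset_nth (enum_val_nth (kset_nth A r)).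
Qed.

Lemma alternating_detrows n k (V : 'M[R]_(n, k)) : alternating (detrows V).
Proof.
have F0 p x t : detrows V (p ++ x :: x :: t) = 0.
  rewrite /detrows; case: eqP => // sz.
  have ltk : ((size p).+1 < k)%N by rewrite -sz size_cat /= !addnS !ltnS leq_addr.
  apply: (@determinant_alternate _ _ _ (Ordinal (ltnW ltk)) (Ordinal ltk)).
    by rewrite -val_eqE /= ltn_eqF.
  move=> c; rewrite !mxE /= map_cat !nth_cat size_map ltnn subnn.
  by rewrite ltnNge leqnSn /= subSnn.
split=> // p x y t; rewrite /detrows !size_cat /=; case: eqP => [sz|]; last by rewrite oppr0.
have ltk : ((size p).+1 < k)%N by rewrite -sz !addnS !ltnS leq_addr.
pose a := Ordinal (ltnW ltk); pose b := Ordinal ltk.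
have ab : a != b by rewrite -val_eqE /= ltn_eqF.
set M := \matrix_r _; set N := \matrix_r _.
have -> : M = xrow a b N.
  apply/matrixP => r c; rewrite !mxE !map_cat !nth_cat !size_map /=.
  case: tpermP => [->|->|/eqP ra /eqP rb] /=.
  - by rewrite ltnn subnn ltnNge leqnSn subSnn.
  - by rewrite ltnn subnn ltnNge leqnSn subSnn.
  case: ltnP => // pr; move: ra rb; rewrite -!val_eqE /=.
  have := subnKC pr; case: (r - size p)%N => [|[|q]] <- //.
    by rewrite addn0 eqxx.
  by rewrite addn1 eqxx.
by rewrite xrowE det_mulmx det_perm odd_tperm ab expr1 mulN1r.
Qed.

Lemma detrows_row_mx n k (v : 'cV[R]_n) (W : 'M[R]_(n, k)) :
  detrows (row_mx v W) =1 laplace (v^~ 0) (detrows W).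
Proof.
case=> [|x t] //; set u := x :: t; rewrite (laplaceE x).
(* At a wrong length both sides vanish, because deleting one entry leaves a list of length other
   than [k]. *)
case: (boolP (size u == k.+1)) => [/eqP sz|nsz]; last first.
  rewrite /detrows (negPf nsz) big1 // => p _.
  have -> : (size (take p u ++ drop p.+1 u) == k) = false.
    apply/negbTE; apply: contra nsz; rewrite size_cat size_takel ?(ltnW (ltn_ord p)) //.
    rewrite size_drop => /eqP <-; rewrite -addnS -subSn ?ltn_ord // subSS subnKC //.
    exact: ltnW.
  by rewrite !mulr0.
rewrite (detrowsE _ x sz) (expand_det_col _ 0) sz; apply: eq_bigr => p _.
have pu : (p < size u)%N by rewrite sz.
have szp : size (take p u ++ drop p.+1 u) = k.
  rewrite size_cat size_takel ?(ltnW pu) // size_drop sz subSS subnKC //.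
  by rewrite -ltnS.
rewrite (detrowsE _ x szp) /cofactor mxE addn0 mulrCA; congr (_ * (_ * _)).
  by rewrite -[RHS](row_mxEl v W); congr (row_mx v W _ _); apply: val_inj.
congr (\det _); apply/matrixP => r c; rewrite !mxE nth_take_drop //.
by rewrite -[RHS](row_mxEr v W) mxE (_ : lift 0 c = rshift 1 c :> 'I_(1 + k)) //; apply: val_inj.
Qed.

Lemma minor_sum_row_mx n k (v : 'cV[R]_n) (W : 'M[R]_(n, k)) :
  minor_sum (row_mx v W)
    + \sum_l (v^T *m Tmx R n) 0 l * presum k (enum 'I_n) (detrows W) l =
  (\sum_i v i 0) * minor_sum W.
Proof.
rewrite !minor_sumE (eq_subsum _ _ (detrows_row_mx v W)).
have := subsum_laplace k (enum 'I_n) (v^~ 0) (alternating_detrows W).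
rewrite tri_form_Tmx ?sorted_enum_ord // !big_enum => <-.
congr (_ + _); apply: eq_bigr => l _; rewrite mxE big_enum; congr (_ * _).
by apply: eq_bigr => i _; rewrite mxE.
Qed.

Lemma minor_sum_thin0 n (V : 'M[R]_(n, 0)) : minor_sum V = 1.
Proof. by rewrite minor_sumE subsum0 /detrows eqxx det_mx00. Qed.

(** By linearity in the first row, weighting row [l] by [z 0 l] replaces that row by
    [c *: delta_mx 0 0]; expanding along it leaves [c] times a minor of [W]. *)
Lemma sum_presum_detrows n k (z : 'rV[R]_n) (v : 'cV_n) (W : 'M_(n, k)) (c : R) :
  z *m row_mx v W = c *: delta_mx 0 0 ->
  \sum_l z 0 l * presum k.+1 (enum 'I_n) (detrows (row_mx v W)) l =
  c * minor_sum W.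
Proof.
move=> zVW; rewrite minor_sumE -subsumZ /=.
under eq_bigr do rewrite -subsumZ.
rewrite exchange_big /=; apply: eq_big_seq => t; rewrite mem_subseqs.
case/andP=> _ /eqP tk.
pose VW := [seq row i (row_mx v W) | i <- t].
(* The cofactors of the first row depend on [t] only, so the sum over [l] can be taken inside. *)
pose cof (j : 'I_k.+1) : R := (-1) ^+ j * \det (\matrix_(r < k, s < k) VW`_r 0 (lift j s)).
have detE l : detrows (row_mx v W) (l :: t) = \sum_j row_mx v W l j * cof j.
  rewrite /detrows /= tk eqxx (expand_det_row _ 0).
  apply: eq_bigr => j _; rewrite !mxE /=; congr (_ * (_ * \det _)).
  by apply/matrixP => r s; rewrite !mxE.
under eq_bigr do rewrite /= detE mulr_sumr.
rewrite exchange_big /=.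
have colE j : \sum_l z 0 l * (row_mx v W l j * cof j) = (c * (j == 0)%:R) * cof j.
  have /matrixP/(_ 0 j) := zVW; rewrite !mxE eqxx /= => <-.
  by rewrite mulr_suml; apply: eq_bigr => l _; rewrite mulrA.
rewrite (eq_bigr _ (fun j _ => colE j)) (bigD1 0) //= ?eqxx mulr1 big1 ?addr0; last first.
  by move=> j /negPf->; rewrite mulr0 mul0r.
congr (_ * _); rewrite /cof expr0 mul1r /detrows tk eqxx; congr (\det _).
apply/matrixP => r s; rewrite !mxE.
have i0 : 'I_n by have := ltn_ord r; rewrite -{2}tk; case: (t) => [|i].
rewrite /VW !(nth_map i0) ?tk ?ltn_ord // !mxE.
by rewrite -[RHS](row_mxEr v W) mxE (_ : lift 0 s = rshift 1 s :> 'I_(1 + k)) //; apply: val_inj.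
Qed.

End MinorSum.

(** * Column operations and congruence *)

Lemma minor_sum_mulmx (R : comNzRingType) n k (V : 'M[R]_(n, k)) (P : 'M_k) :
  minor_sum (V *m P) = minor_sum V * \det P.
Proof.
rewrite /minor_sum mulr_suml; apply: eq_bigr => A _.
by rewrite -mul_rowsub_mx det_mulmx.
Qed.

Lemma Tmx_add_tr (R : comNzRingType) n : Tmx R n + (Tmx R n)^T = const_mx 2.
Proof.
apply/matrixP => i j; rewrite !mxE -/(Tmx R n); have := TmxE R i j; have := TmxE R j i.
rewrite !mxE => -> ->; rewrite -!val_eqE /=.
by case: ltngtP => _; rewrite ?add0r ?addr0 // -mulr2n.
Qed.

(** If column [j] of [V] sums to zero, row [j] and column [j] of [M] are therefore opposite. *)
Lemma Tmx_congr_add (R : comNzRingType) n k (V : 'M[R]_(n, k)) i j :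
  let M := V^T *m Tmx R n *m V in
  M i j + M j i = 2 * ((\sum_l V l i) * \sum_l V l j).
Proof.
set M := _ *m V => /=.
have /matrixP/(_ i j) : M + M^T = V^T *m const_mx 2 *m V.
  by rewrite /M !trmx_mul trmxK mulmxA -mulmxDl -mulmxDr Tmx_add_tr.
rewrite 2!mxE [M^T i j]mxE => ->; rewrite mxE mulr_sumr mulr_sumr.
apply: eq_bigr => l _; rewrite mxE mulrA; congr (_ * _).
by rewrite mulr_sumr; apply: eq_bigr => s _; rewrite !mxE mulrC.
Qed.

(** Expansion along the first row and then the first column picks up [c], the cofactor sign -1 and
    [- c]. *)
Lemma det_skew_corner (R : comNzRingType) k (M : 'M[R]_k.+2) c :
  (forall j, M 0 j = c * (j == 1)%:R) -> (forall i, M i 0 = - c * (i == 1)%:R) ->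
  \det M = c ^+ 2 * \det (row' 0 (col' 0 (row' 0 (col' 0 M)))).
Proof.
move=> M0 M0'.
rewrite (expand_det_row M 0) (bigD1 1) //= M0 eqxx mulr1.
rewrite big1 ?addr0; last by move=> j /negPf j1; rewrite M0 j1 mulr0 mul0r.
rewrite /cofactor (expand_det_col _ 0) (bigD1 0) //= big1 ?addr0; last first.
  move=> i i0; rewrite !mxE (_ : lift 1 0 = 0); last exact: val_inj.
  by rewrite M0' (_ : (_ == _) = false) ?mulr0 ?mul0r //; case: i i0 => [[]].
rewrite !mxE (_ : lift 1 0 = 0); last exact: val_inj.
rewrite M0' (_ : lift 0 0 = 1); last exact: val_inj.
rewrite eqxx /cofactor !expr0 !mul1r.
have -> : row' 0 (col' 0 (row' 0 (col' 1 M))) = row' 0 (col' 0 (row' 0 (col' 0 M))).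
  apply/matrixP => i j; rewrite !mxE; congr (M _ _); exact: val_inj.
by rewrite modn_small // add0n expr1 mulr1; ring.
Qed.

Lemma row'_col'_block_mx (R : Type) k a b c (d : 'M[R]_k) :
  row' 0 (col' 0 (block_mx a b c d : 'M_(1 + k))) = d.
Proof.
apply/matrixP => i j; rewrite -(block_mxEdr a b c d) 2![LHS]mxE.
by congr (block_mx a b c d _ _); apply: val_inj.
Qed.

Lemma row_unit_delta (F : fieldType) k (y : 'rV[F]_k.+1) :
  exists2 Q, Q \in unitmx & exists c, y *m Q = c *: delta_mx 0 0.
Proof.
exists (invmx (row_ebase y)); first by rewrite unitmx_inv row_ebase_unit.
(* In [y = col_ebase y *m pid_mx (\rank y) *m row_ebase y] the left factor is a scalar; the Boolean
   factor covers [y = 0]. *)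
exists (col_ebase y 0 0 * (0 < \rank y)%:R).
rewrite -{1}(mulmx_ebase y) mulmxK ?row_ebase_unit //.
apply/rowP => j; rewrite !mxE big_ord1 !mxE ord1 -mulrA; congr (_ * _).
rewrite eqxx andTb eq_sym -natrM mulnb andbC.
by rewrite -val_eqE.
Qed.

(** * The square identity in characteristic zero *)

Section Square.
Variable F : numFieldType.

Let square n k (V : 'M[F]_(n, k)) :=
  \det (V^T *m Tmx F n *m V) = minor_sum V ^+ 2.

Let square_mulmx n k (V : 'M[F]_(n, k)) P :
  P \in unitmx -> square (V *m P) -> square V.
Proof.
rewrite unitmxE unitfE => P0; rewrite /square minor_sum_mulmx trmx_mul.
have -> : P^T *m V^T *m Tmx F n *m (V *m P) = P^T *m (V^T *m Tmx F n *m V) *m P.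
  by rewrite !mulmxA.
rewrite !det_mulmx det_tr => e.
by apply: (mulIf P0); apply: (mulfI P0); rewrite mulrA e; ring.
Qed.

Let square_reduced n k (v u : 'cV[F]_n) (V : 'M_(n, k)) c :
  \sum_i v i 0 = 0 -> v^T *m Tmx F n *m row_mx u V = c *: delta_mx 0 0 ->
  square V -> square (row_mx v (row_mx u V)).
Proof.
move=> v0 vT sqV; rewrite /square.
have := minor_sum_row_mx v (row_mx u V).
rewrite (sum_presum_detrows vT) v0 mul0r => /eqP; rewrite addr_eq0 => /eqP ->.
rewrite sqrrN exprMn -sqV.
set W := row_mx v _; set M := _ *m W.
have W0 l : W l 0 = v l 0.
  by rewrite -[RHS](row_mxEl v (row_mx u V)); congr (W l _); apply: val_inj.
have ME : M = block_mx (v^T *m Tmx F n *m v) (v^T *m Tmx F n *m row_mx u V)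
    ((row_mx u V)^T *m Tmx F n *m v) ((row_mx u V)^T *m Tmx F n *m row_mx u V).
  by rewrite /M /W tr_row_mx mul_col_mx mul_col_row.
have M0 j : M 0 j = c * (j == 1)%:R.
  (* Twice this entry is twice the square of the sum of [v], and 2 is nonzero in [F]. *)
  have M00 : M 0 0 = 0.
    have := Tmx_congr_add W 0 0; rewrite /= -/M (eq_bigr _ (fun l _ => W0 l)) v0.
    by rewrite mul0r mulr0 -mulr2n => /eqP; rewrite mulrn_eq0 /= => /eqP.
  have [j' ->|->] := unliftP 0 j; last by rewrite M00 mulr0.
  have -> : M 0 (lift 0 j') = (v^T *m Tmx F n *m row_mx u V) 0 j'.
    rewrite ME -(block_mxEur (v^T *m Tmx F n *m v) _
      ((row_mx u V)^T *m Tmx F n *m v) ((row_mx u V)^T *m Tmx F n *m row_mx u V)).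
    by congr (block_mx _ _ _ _ _ _); apply: val_inj.
  by rewrite vT !mxE eqxx.
have M0' i : M i 0 = - c * (i == 1)%:R.
  have := Tmx_congr_add W i 0; rewrite /= -/M (eq_bigr _ (fun l _ => W0 l)) v0.
  by rewrite !mulr0 M0 mulNr => /eqP; rewrite addr_eq0 => /eqP.
rewrite (det_skew_corner M0 M0'); congr (_ * \det _).
rewrite ME row'_col'_block_mx tr_row_mx mul_col_mx mul_col_row.
exact: row'_col'_block_mx.
Qed.

Lemma det_Tmx_congr n k (V : 'M[F]_(n, k)) :
  \det (V^T *m Tmx F n *m V) = minor_sum V ^+ 2.
Proof.
rewrite -/(square V).
(* Each reduction removes two columns, so the induction carries two consecutive widths. *)
have [//] : (forall V : 'M[F]_(n, k), square V) /\
            (forall V : 'M[F]_(n, k.+1), square V).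
elim: k {V} => [|k [IH0 IH1]]; split=> // V.
- by rewrite /square det_mx00 minor_sum_thin0 expr1n.
- have VE : V = row_mx (lsubmx (V : 'M_(n, 1 + 0))) (rsubmx (V : 'M_(n, 1 + 0))).
    by rewrite hsubmxK.
  have := minor_sum_row_mx (lsubmx (V : 'M_(n, 1 + 0))) (rsubmx (V : 'M_(n, 1 + 0))).
  rewrite -VE minor_sum_thin0 mulr1 big1 ?addr0 => [sE|l _]; last by rewrite mulr0.
  rewrite /square sE det_mx11.
  have := Tmx_congr_add V 0 0; rewrite /= -mulr2n -[LHS]mulr_natl.
  move/(mulfI (_ : 2 != 0 :> F)); rewrite pnatr_eq0 => -> //; rewrite expr2.
  have sV : \sum_l V l 0 = \sum_i lsubmx (V : 'M_(n, 1 + 0)) i 0.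
    by apply: eq_bigr => i _; rewrite mxE; congr (V i _); apply: val_inj.
  by rewrite sV.
(* [const_mx 1 *m V] is the row of column sums. [Q] makes all of them but the first zero, and the
   transposition then brings a zero-sum column to the front. *)
have [Q uQ [c wQ]] := row_unit_delta (const_mx 1 *m V : 'rV_(k.+2)).
apply: (square_mulmx (P := Q *m tperm_mx 0 1)).
  by rewrite unitmx_mul uQ unitmx_perm.
rewrite mulmxA -xcolE; set V1 : 'M_(n, 1 + k.+1) := xcol _ _ _.
have v0 : \sum_i lsubmx V1 i 0 = 0.
  have := congr1 (fun A : 'rV_ _ => A 0 1) wQ.
  rewrite -mulmxA !mxE eqxx mulr0; apply: etrans; apply: eq_bigr => i _.
  rewrite [lsubmx V1 i 0]mxE [V1 _ _]mxE [const_mx _ _ _]mxE mul1r.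
  have -> : lshift k.+1 (0 : 'I_1) = 0 :> 'I_(k.+2) by apply: val_inj.
  by rewrite tpermL.
rewrite -(hsubmxK V1); set v := lsubmx V1 in v0 *; set W := rsubmx V1.
(* [Q2] acts on the other columns only, so the zero sum of [v] survives. *)
have [Q2 uQ2 [d yQ2]] := row_unit_delta (v^T *m Tmx F n *m W).
apply: (square_mulmx (P := block_mx (1%:M : 'M_1) 0 0 Q2)).
  by rewrite unitmxE det_lblock det1 mul1r -unitmxE.
rewrite mul_row_block !mulmx0 mulmx1 add0r addr0.
set W2 : 'M_(n, 1 + k) := W *m Q2.
rewrite -(hsubmxK W2); apply: (square_reduced (c := d)) => //.
by rewrite hsubmxK mulmxA.
Qed.

End Square.

(** * The Cauchy-Binet formula *)

Lemma kset_nth_inj n k (A : kset n k) : injective (kset_nth A).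
Proof. by move=> r s /enum_val_inj/cast_ord_inj. Qed.

(** Parametrises the injective maps from ['I_k] to ['I_n] by their image and a permutation. *)
Definition kset_perm n k (p : kset n k * 'S_k) : {ffun 'I_k -> 'I_n} :=
  [ffun r => kset_nth p.1 (p.2 r)].

Lemma kset_perm_inj n k : injective (@kset_perm n k).
Proof.
move=> [A s] [B t] /ffunP eAB.
have im (C : kset n k) (u : 'S_k) : val C = [set kset_perm (C, u) r | r in 'I_k].
  rewrite -(kset_nth_image C); apply/setP => x.
  apply/imsetP/imsetP => -[r _ ->]; last by exists (u r); rewrite ?ffunE.
  by exists ((u^-1)%g r); rewrite ?ffunE ?permKV.
have AB : A = B.
  apply: val_inj; rewrite (im A s) (im B t).
  by apply: eq_imset => r; apply: eAB.
rewrite {}AB in eAB *; congr (_, _); apply/permP => r.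
by have := eAB r; rewrite !ffunE => /kset_nth_inj.
Qed.

Lemma kset_permP n k (f : {ffun 'I_k -> 'I_n}) :
  reflect (injective f) (f \in [set kset_perm p | p : kset n k * 'S_k]).
Proof.
apply: (iffP imsetP) => [[[A s] _ ->] r t|finj].
  by rewrite !ffunE => /kset_nth_inj/perm_inj.
have cardf : #|[set f r | r : 'I_k]| == k by rewrite card_imset // card_ord.
pose A : kset n k := exist _ [set f r | r : 'I_k] cardf.
have /fin_all_exists[h hE] r : exists s, f r = kset_nth A s.
  have : f r \in val A by apply: imset_f.
  by rewrite -(kset_nth_image A) => /imsetP[s _ ->]; exists s.
have hinj : injective h by move=> r s hrs; apply: finj; rewrite !hE hrs.
by exists (A, perm hinj) => //; apply/ffunP => r; rewrite ffunE permE.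
Qed.

Lemma det_mulmx_ffun (R : comNzRingType) k m (A : 'M[R]_(k, m)) (B : 'M_(m, k)) :
  \det (A *m B) =
  \sum_(f : {ffun 'I_k -> 'I_m}) (\prod_r A r (f r)) * \det (rowsub f B).
Proof.
rewrite /determinant.
under eq_bigr => s _.
  under eq_bigr => i _ do rewrite mxE.
  rewrite bigA_distr_bigA mulr_sumr; over.
rewrite exchange_big /=; apply: eq_bigr => f _; rewrite mulr_sumr.
apply: eq_bigr => s _; rewrite big_split /= mulrCA; congr (_ * (_ * _)).
by apply: eq_bigr => i _; rewrite mxE.
Qed.

(** In [det_mulmx_ffun] a non-injective [f] repeats a row of [B] and contributes 0. The injective
    ones are grouped by image, and the signs of their permutations assemble the determinant of the
    columns of [A]. *)
Lemma Cauchy_Binet (R : comNzRingType) k m (A : 'M[R]_(k, m)) (B : 'M_(m, k)) :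
  \det (A *m B) =
  \sum_(K : kset m k) \det (colsub (kset_nth K) A) * \det (rowsub (kset_nth K) B).
Proof.
rewrite det_mulmx_ffun (bigID (mem [set kset_perm p | p : kset m k * 'S_k])) /=.
rewrite [X in _ + X]big1 ?addr0; last first.
  move=> f /kset_permP finj.
  have /injectivePn[r [s rs frs]] : ~~ injectiveb f by apply/injectiveP.
  by rewrite (determinant_alternate rs) ?mulr0 // => c; rewrite !mxE frs.
rewrite big_imset /=; last by move=> p q _ _; apply: kset_perm_inj.
rewrite (eq_bigl (fun=> true)) // -(pair_bigA _ (fun K s =>
  (\prod_r A r (kset_perm (K, s) r)) * \det (rowsub (kset_perm (K, s)) B))) /=.
apply: eq_bigr => K _; rewrite [X in X * _]/determinant mulr_suml.
apply: eq_bigr => s _.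
have -> : rowsub (kset_perm (K, s)) B = row_perm s (rowsub (kset_nth K) B).
  by apply/matrixP => r c; rewrite !mxE ffunE.
rewrite row_permE det_mulmx det_perm mulrA [_ * (-1) ^+ _]mulrC; congr (_ * _ * _).
by apply: eq_bigr => r _; rewrite mxE ffunE.
Qed.

Lemma minorE (R : comNzRingType) n k (A : 'M[R]_n) (K L : kset n k) :
  minor A K L = \det (mxsub (kset_nth K) (kset_nth L) A).
Proof. by congr (\det _); apply/matrixP => r s; rewrite !mxE. Qed.

Lemma minor_mulmx (R : comNzRingType) n m k (A : 'M[R]_(n, m)) (B : 'M_(m, n))
  (I J : kset n k) :
  minor (A *m B) I J = \sum_(K : kset m k)
    \det (mxsub (kset_nth I) (kset_nth K) A) *
    \det (mxsub (kset_nth K) (kset_nth J) B).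
Proof.
rewrite minorE mxsub_mul Cauchy_Binet; apply: eq_bigr => K _.
by rewrite -mxsubcr -mxsubrc.
Qed.

Lemma det_mxsub_diag_mulmx (R : comNzRingType) m n k d (B : 'M[R]_(m, n))
    (f : 'I_k -> 'I_m) (g : 'I_k -> 'I_n) :
  \det (mxsub f g (diag_mx d *m B)) = (\prod_r d 0 (f r)) * \det (mxsub f g B).
Proof.
have -> : mxsub f g (diag_mx d *m B) = diag_mx (\row_r d 0 (f r)) *m mxsub f g B.
  by rewrite !mul_diag_mx; apply/matrixP => r s; rewrite !mxE.
by rewrite det_mulmx det_diag; congr (_ * _); apply: eq_bigr => r _; rewrite mxE.
Qed.

(** * Passage to arbitrary commutative rings *)

Lemma map_Tmx (R S : comNzRingType) (f : {rmorphism R -> S}) n :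
  map_mx f (Tmx R n) = Tmx S n.
Proof. by apply/matrixP => i j; rewrite !mxE rmorphD rmorph1 rmorph_int. Qed.

Lemma map_minor_sum (R S : comNzRingType) (f : {rmorphism R -> S}) n k
  (V : 'M[R]_(n, k)) : minor_sum (map_mx f V) = f (minor_sum V).
Proof.
rewrite /minor_sum rmorph_sum /=; apply: eq_bigr => K _.
by rewrite -map_mxsub det_map_mx.
Qed.

Lemma det_map_Tmx_congr (R S : comNzRingType) (f : {rmorphism R -> S}) n k
    (V : 'M[R]_(n, k)) :
  \det ((map_mx f V)^T *m Tmx S n *m map_mx f V) = f (\det (V^T *m Tmx R n *m V)).
Proof. by rewrite -(map_Tmx f) map_trmx -!map_mxM det_map_mx. Qed.

(** Both sides are images of integers, which agree because they agree in [rat]. *)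
Lemma det_Tmx_congr_int (R : comNzRingType) n k (V : 'M[int]_(n, k)) :
  let W := map_mx intr V : 'M[R]_(n, k) in
  \det (W^T *m Tmx R n *m W) = minor_sum W ^+ 2.
Proof.
rewrite /= det_map_Tmx_congr map_minor_sum -rmorphXn; congr (intr _).
apply: (@intr_inj rat); rewrite -det_map_Tmx_congr det_Tmx_congr.
by rewrite map_minor_sum rmorphXn.
Qed.

(* Holds over every commutative ring because no division by 2 is needed:
   [E_ij + E_ji = (e_i + e_j)(e_i + e_j)^T - e_i e_i^T - e_j e_j^T]. *)
Lemma symmetric_int_diag (R : comNzRingType) n (X : 'M[R]_n) : X^T = X ->
  exists m (V : 'M[int]_(n, m)) (d : 'rV[R]_m),
    X = map_mx intr V *m (diag_mx d *m (map_mx intr V)^T).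
Proof.
move=> symX; pose P (Y : 'M[R]_n) := exists m (V : 'M[int]_(n, m)) (d : 'rV[R]_m),
    Y = map_mx intr V *m (diag_mx d *m (map_mx intr V)^T).
have P0 : P 0 by exists 0%N, 0, 0; rewrite map_mx0 mul0mx.
have PD Y Z : P Y -> P Z -> P (Y + Z).
  move=> [m1 [V1 [d1 ->]]] [m2 [V2 [d2 ->]]].
  exists (m1 + m2)%N, (row_mx V1 V2), (row_mx d1 d2).
  rewrite map_row_mx diag_mx_row tr_row_mx mul_block_col mul_row_col.
  by rewrite !mul0mx addr0 add0r.
have P1 a (v : 'cV[int]_n) : P (a *: (map_mx intr v *m (map_mx intr v)^T)).
  exists 1%N, v, (const_mx a).
  by rewrite diag_const_mx mul_scalar_mx -scalemxAr.
pose e (i : 'I_n) : 'cV[int]_n := delta_mx i 0.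
pose D (i j : 'I_n) : 'M[R]_n := delta_mx i j.
have De i j : D i j = map_mx intr (e i) *m (map_mx intr (e j))^T.
  by rewrite /e !map_delta_mx trmx_delta mul_delta_mx.
have Pii a i : P (a *: D i i) by rewrite De.
have Pij a i j : P (a *: (D i j + D j i)).
  have -> : D i j + D j i =
      map_mx intr (e i + e j) *m (map_mx intr (e i + e j))^T - D i i - D j j.
    rewrite map_mxD linearD /= mulmxDl !mulmxDr -!De.
    by apply/matrixP => r c; rewrite !mxE; ring.
  by rewrite !scalerBr -!scaleNr; do 2?[apply: (PD) => //].
have -> : X = \sum_i (X i i *: D i i + \sum_(j : 'I_n | (i < j)%N) X i j *: (D i j + D j i)).
  rewrite {1}(matrix_sum_delta X) big_split /=.
  under [X in _ + X]eq_bigr do under eq_bigr do rewrite scalerDr.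
  under [X in _ + X]eq_bigr do rewrite big_split /=.
  (* Exchanging the sums makes the [D j i] terms the part of row [i] below the diagonal, with
     coefficients matched by the symmetry of [X]. *)
  rewrite big_split /= [X in _ + (_ + X)](exchange_big_dep xpredT) //=.
  rewrite -!big_split /=; apply: eq_bigr => i _.
  rewrite (bigD1 i) //= (bigID (fun j : 'I_n => (i < j)%N)) /=.
  congr (_ + (_ + _)); first by apply: eq_bigl => j; rewrite -val_eqE /=; case: ltngtP.
  apply: eq_big => [j|j _]; first by rewrite -val_eqE /=; case: ltngtP.
  by rewrite -{1}symX mxE.
apply: (big_ind P) => // i _; apply: (PD) => //.
by apply: (big_ind P).
Qed.

Theorem theorem1 (R : comNzRingType) (n : nat) (hn : (1 <= n)%N)
  (X : 'M[R]_n) (hX : X^T = X) (k : nat) (hk : (1 <= k <= n)%N) :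
  \sum_(I : kset n k) minor (Tmx R n *m X) I I =
  \sum_(I : kset n k) \sum_(J : kset n k) minor X I J.
Proof.
have [m [V0 [d ->]]] := symmetric_int_diag hX.
set V := map_mx intr V0; pose dK (K : kset m k) := \prod_r d 0 (kset_nth K r).
pose N (I : kset n k) (K : kset m k) := \det (mxsub (kset_nth I) (kset_nth K) V).
have DVT (I : kset n k) K : \det (mxsub (kset_nth K) (kset_nth I) (diag_mx d *m V^T))
    = dK K * N I K.
  by rewrite det_mxsub_diag_mulmx -trmx_mxsub det_tr.
have NK K : \sum_I N I K = minor_sum (colsub (kset_nth K) V).
  by apply: eq_bigr => I _; rewrite -mxsubrc.
transitivity (\sum_(K : kset m k) dK K * minor_sum (colsub (kset_nth K) V) ^+ 2).
  rewrite mulmxA; under eq_bigr do rewrite minor_mulmx.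
  rewrite exchange_big /=; apply: eq_bigr => K _.
  under eq_bigr do rewrite DVT mulrCA.
  rewrite -mulr_sumr; congr (_ * _).
  (* For fixed [K] the square becomes the determinant of the congruence of T by the columns [K] of
     [V]; Cauchy-Binet expands it into the sum over [I]. *)
  rewrite /V -map_mxsub -det_Tmx_congr_int map_mxsub -/V -mulmxA Cauchy_Binet.
  apply: eq_bigr => I _; rewrite mulrC; congr (_ * _).
    by rewrite -det_tr trmx_mxsub trmxK -mxsubrc.
  by rewrite mulmx_colsub -mxsubrc.
under [RHS]eq_bigr do under eq_bigr do rewrite minor_mulmx.
under [RHS]eq_bigr do rewrite exchange_big.
rewrite exchange_big /=; apply: eq_bigr => K _.
under eq_bigr do under eq_bigr do rewrite DVT mulrCA.
(* For fixed [K] the summand is a product of a factor in [I] and one in [J], so the double sum is a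
   square. *)
under eq_bigr do rewrite -mulr_sumr -mulr_sumr.
by rewrite -mulr_sumr -mulr_suml NK -expr2.
Qed.
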